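(* Let $n\geq 1$, let $Q_{n-1}$ be a polynomial of degree at most $n-1$ satisfying conditions (i) and (ii) of the context, with nodes $x_{n,k}$, and let $R_n$ be the associated rational Bernstein operator. Put $\Delta_n=\sup_{0\leq k\leq n-1}|x_{n,k+1}-x_{n,k}|$. Then for all $f\in C[0,1]$ and all $x\in[0,1]$, $$\left|R_nf(x)-f(x)\right|\leq\left(1+\tfrac12 x(1-x)\right)\omega_2\left(f,\sqrt{\Delta_n}\right).$$
   Context: $C[0,1]$ is the space of continuous real-valued functions on $[0,1]$. The second modulus of continuity of $f\in C[0,1]$ is $\omega_2(f,h)=\sup\{|f(x+\delta)-2f(x)+f(x-\delta)|: |\delta|\leq h,\ x\pm\delta\in[0,1]\}$, $h>0$. Let $n\geq 1$ and let $Q_{n-1}$ be a polynomial of degree at most $n-1$, strictly positive on $[0,1]$. Write $Q_{n-1}(x)=\sum_{k=0}^{n-1}\gamma_{n-1,k}\,x^k(1-x)^{n-1-k}$ and $\gamma_{n-1,k}=w_{n-1,k}\binom{n-1}{k}$, so that the $w_{n-1,k}$ are the Bernstein coefficients of $Q_{n-1}$. Conditions: (i) $w_{n-1,k}>0$ for $k=0,\dots,n-1$; (ii) property (W): $\frac{w_{n-1,k-1}w_{n-1,k+1}}{w_{n-1,k}^2}<\frac{k+1}{k}\cdot\frac{n-k}{n-k-1}$ for $k=1,\dots,n-2$ (equivalently, $\gamma_{n-1,k-1}/\gamma_{n-1,k}$ is strictly increasing in $k=1,\dots,n-1$). Convention: $\gamma_{n-1,-1}=\gamma_{n-1,n}=0$.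 The nodes are $x_{n,k}=\frac{\gamma_{n-1,k-1}}{\gamma_{n-1,k}+\gamma_{n-1,k-1}}$ for $k=0,\dots,n$; under (i) and (ii) one has $0=x_{n,0}<x_{n,1}<\dots<x_{n,n}=1$. The rational Bernstein operator associated with $Q_{n-1}$ is $$R_nf(x)=\sum_{k=0}^{n}f(x_{n,k})\,(\gamma_{n-1,k}+\gamma_{n-1,k-1})\,\frac{x^k(1-x)^{n-k}}{Q_{n-1}(x)},\qquad f\in C[0,1],$$ which reproduces the functions $1$ and $x$. *)

(* Defs.v *)
From HB Require Import structures.
From mathcomp Require Import all_boot all_order all_algebra.
From mathcomp Require Import all_classical all_reals all_analysis.
Set Implicit Arguments.
Unset Strict Implicit.
Unset Printing Implicit Defensive.
Import Order.TTheory GRing.Theory Num.Theory.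
Import numFieldNormedType.Exports.
Local Open Scope classical_set_scope.
Local Open Scope ring_scope.

Section RationalBernstein.
Variable R : realType.

(* Functions on [0, 1] are total functions on R; only their values on [0, 1]
   are used here. *)
Definition omega2 (f : R -> R) (h : R) : R :=
  sup [set y | exists x d : R,
    [/\ `|d| <= h, x + d \in `[0, 1], x - d \in `[0, 1]
      & y = `|f (x + d) - 2 * f x + f (x - d)|]].

(* gamma n w k is gamma_{n-1,k} = w_{n-1,k} 'C(n-1, k) for 0 <= k <= n - 1.
   The index is an integer so that gamma_{n-1,-1} = gamma_{n-1,n} = 0 makes
   sense; values of w outside 0, ..., n - 1 are never used. *)
Definition gamma (n : nat) (w : nat -> R) (k : int) : R :=
  match k with
  | Posz j => if (j < n)%N then w j * 'C(n.-1, j)%:R else 0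
  | Negz _ => 0
  end.

Definition bernstein_expansion (n : nat) (w : nat -> R) (Q : {poly R}) : Prop :=
  Q = \sum_(k < n) gamma n w k%:Z *: ('X^k * (1 - 'X) ^+ (n.-1 - k)).

(* k ranges over 1, ..., n - 2, so the natural number subtractions are exact. *)
Definition propertyW (n : nat) (w : nat -> R) : Prop :=
  forall k : nat, (0 < k)%N -> (k.+1 < n)%N ->
    w k.-1 * w k.+1 / w k ^+ 2
      < (k.+1)%:R / k%:R * ((n - k)%:R / (n - k - 1)%:R).

Definition node (n : nat) (w : nat -> R) (k : nat) : R :=
  gamma n w (k%:Z - 1) / (gamma n w k%:Z + gamma n w (k%:Z - 1)).

Definition rational_bernstein (n : nat) (w : nat -> R) (Q : {poly R})
    (f : R -> R) (x : R) : R :=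
  \sum_(k < n.+1) f (node n w k) * (gamma n w k%:Z + gamma n w (k%:Z - 1))
    * (x ^+ k * (1 - x) ^+ (n - k) / Q.[x]).

Definition mesh (n : nat) (w : nat -> R) : R :=
  sup [set `|node n w k.+1 - node n w k| | k in [set k : nat | (k < n)%N]].

End RationalBernstein.

(* Main.v *)
Require Import Defs.
From HB Require Import structures.
From mathcomp Require Import all_boot all_order all_algebra.
From mathcomp Require Import all_classical all_reals all_analysis.
From mathcomp Require Import ring lra zify.
Import Order.TTheory GRing.Theory Num.Theory.
Import numFieldNormedType.Exports.
Local Open Scope classical_set_scope.
Local Open Scope ring_scope.

(** For fixed x, the operator integrates f against a probability measure on the
nodes: the node x_k has mass p_k = (gamma_k + gamma_(k-1)) x^k (1-x)^(n-k) / Q(x).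
With q_j = gamma_j x^j (1-x)^(n-1-j) / Q(x), which also sum to 1, splitting each
p_k into its two halves gives

  R_n f (x) = sum_j q_j ((1 - x) f(x_j) + x f(x_(j+1)))     ([sum_node_mass]),

and x_k (gamma_k + gamma_(k-1)) = gamma_(k-1) gives

  sum_k p_k x_k F(x_k) = x sum_j q_j F(x_(j+1))      ([node_mass_mean_mul]).

Together they show that the measure has mean x and variance exactly
x (1 - x) sum_j q_j (x_(j+1) - x_j), hence at most x (1 - x) times the mesh
([node_mass_variance_le]).

The rest holds for any finitely supported probability measure on [0, 1] with
mean x and variance V: for every h > 0, the average of f differs from f(x) by at
most (1 + V / (2 h^2)) omega2 f h ([centered_average_le]).  The choice
h = sqrt mesh then makes V / (2 h^2) at most x (1 - x) / 2.

For a measure with two atoms u < x < v, where V = (x - u) (v - x), the claim is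
[chord_deviation_le].  It is a maximum principle: let g be f minus its chord on
[u, v] and K = omega2 f h.  Subtracting a parabola that vanishes at u and v and
whose second difference of step h is slightly below - K makes the second
differences of step h positive, so that the resulting function phi cannot be
maximal at distance at least h from both ends.  If a maximum c is within h of its
nearer end, say u, the reflection 2 c - u stays in [u, v]; since phi u = 0 and
phi (2 c - u) <= phi c, the second difference at c yields phi c <= K.

The two-atom case implies the general one by separation
([centered_sum_le0]): the two-atom inequalities provide one slope m such that
f(x) - f(t) - K (t - x)^2 / (2 h^2) - K <= m (t - x) at every atom t, and the
right-hand side averages to 0.  Applying this to f and to - f bounds the
absolute value. *)

(** * The second modulus of continuity *)

(** Continuity matters here: the supremum defining [omega2] is an upper bound only
because f is bounded on the unit interval. *)
Lemma second_difference_le_omega2 (R : realType) (f : R -> R) (h y d : R) :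
  {within `[0, 1], continuous f} -> `|d| <= h ->
  y + d \in `[0, 1] -> y - d \in `[0, 1] ->
  `|f (y + d) - 2 * f y + f (y - d)| <= omega2 f h.
Proof.
move=> fc dh yd1 yd2; apply: ub_le_sup; last by exists y, d.
have [M [_ fM]] := compact_bounded (continuous_compact fc (@segment_compact _ 0 1)).
have {fM}fM t : t \in `[0, 1] -> `|f t| <= M + 1.
  by move=> t01; apply: (fM (M + 1)); [rewrite ltrDl | exists t].
exists (4 * (M + 1)) => _ [z [e [_ z1 z2 ->]]].
have zI : z \in `[0, 1] by move: z1 z2; rewrite !in_itv /=; lra.
have := fM _ z1; have := fM _ z2; have := fM _ zI.
rewrite !ler_norml; lra.
Qed.

(** * Deviation of a function from its chord *)

Lemma within_continuous_sub_quadratic (R : realType) (A : set R) (g : R -> R)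
    (a b c : R) :
  {within A, continuous g} ->
  {within A, continuous (fun t => g t - (a + b * t + c * t ^+ 2))}.
Proof.
move=> gc; apply: (@within_continuousB _ _ _ _ g) => //.
apply: continuous_subspaceT => t.
apply: (@continuousD _ _ _ (fun t : R => a + b * t) (fun t => c * t ^+ 2)).
  apply: (@continuousD _ _ _ (fun t : R => a) (fun t => b * t)).
    exact: cst_continuous.
  exact: mulrl_continuous.
apply: (@continuous_comp _ _ _ (fun t : R => t ^+ 2) ( *%R c)).
  exact: exprn_continuous.
exact: mulrl_continuous.
Qed.

(** Maximum principle behind the two-atom estimate.  The strict inequality K < C
makes the function phi below strictly convex for steps of length h, which
excludes maxima far from both ends. *)
Lemma le_parabola_of_second_difference (R : realType) (g : R -> R)
    (u v h K C : R) :
  0 < h -> K < C -> u <= v -> g u = 0 -> g v = 0 ->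
  {within `[u, v], continuous g} ->
  (forall y d, 0 <= d <= h -> u <= y - d -> y + d <= v ->
     - K <= g (y + d) - 2 * g y + g (y - d)) ->
  {in `[u, v], forall x, g x <= K + C / (2 * h ^+ 2) * ((x - u) * (v - x))}.
Proof.
move=> h0 KC uv gu gv gc gK x xuv.
(* The step 0 forces the bound on second differences to be nonnegative. *)
have K0 : 0 <= K.
  have := gK u 0; rewrite addr0 subr0 gu lexx (ltW h0) => /(_ isT (lexx _) uv).
  by rewrite mulr0 subr0 addr0; lra.
set B := C / (2 * h ^+ 2).
have Bh : B * h ^+ 2 = C / 2 by rewrite /B; field; lra.
have B0 : 0 <= B by apply: divr_ge0; [lra | rewrite mulr_ge0 ?sqr_ge0].
set phi := fun t => g t - B * ((t - u) * (v - t)).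
have phic : {within `[u, v], continuous phi}.
  have -> : phi = fun t => g t -
      (- (B * u * v) + (B * (u + v)) * t + (- B) * t ^+ 2).
    by apply/funext => t; rewrite /phi; ring.
  exact: within_continuous_sub_quadratic.
have [c] := EVT_max uv phic.
rewrite in_itv /= => /andP[uc cv] cmax.
have phi_uv t : u <= t -> t <= v -> phi t <= phi c.
  by move=> ut tv; apply: cmax; rewrite in_itv /= ut tv.
(* The second difference of the parabola with step d is - 2 * B * d ^+ 2. *)
have step d : 0 <= d <= h -> u <= c - d -> c + d <= v ->
    2 * phi c + 2 * B * d ^+ 2 <= phi (c + d) + phi (c - d) + K.
  by move=> dh ucd cdv; have := gK c d dh ucd cdv; rewrite /phi; lra.
suff : phi c <= K.
  move: xuv; rewrite in_itv /= => /andP[ux xv].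
  by have := phi_uv x ux xv; rewrite /phi; lra.
have phiu : phi u = 0 by rewrite /phi gu; ring.
have phiv : phi v = 0 by rewrite /phi gv; ring.
have Bsq d : 0 <= B * d ^+ 2 by rewrite mulr_ge0 ?sqr_ge0.
(* A maximum at distance at least h from both ends would violate [step],
   because then 2 * B * h ^+ 2 = C > K. *)
have near_end : (c - u < h) || (v - c < h).
  apply: contraT; rewrite negb_or -!leNgt => /andP[hu hv].
  have := step h; rewrite lexx ltW //= => /(_ isT).
  have := phi_uv (c + h); have := phi_uv (c - h); lra.
(* Reflecting the nearest end in c gives a point where phi <= phi c. *)
have [cu_le|vc_lt] := lerP (c - u) (v - c).
  have := step (c - u); have -> : c - (c - u) = u by ring.
  have := phi_uv (c + (c - u)); have := Bsq (c - u).
  rewrite phiu; lra.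
have := step (v - c); have -> : c + (v - c) = v by ring.
have := phi_uv (c - (v - c)); have := Bsq (v - c).
rewrite phiv; lra.
Qed.

(** Two-atom case, multiplied by v - u: the left-hand side is v - u times the gap
between f x and the chord at x, and (x - u) * (v - x) is the variance of the
measure on u and v with mean x.  The constant C of
[le_parabola_of_second_difference] is let tend to K. *)
Lemma chord_deviation_le (R : realType) (f : R -> R) (u v h K x : R) :
  0 < h -> {within `[u, v], continuous f} ->
  (forall y d, 0 <= d <= h -> u <= y - d -> y + d <= v ->
     - K <= f (y + d) - 2 * f y + f (y - d)) ->
  u < x < v ->
  (v - u) * f x - (v - x) * f u - (x - u) * f v
    <= (v - u) * (K + K / (2 * h ^+ 2) * ((x - u) * (v - x))).
Proof.
move=> h0 fc fK /andP[ux xv].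
have uv : u < v by exact: lt_trans xv.
set s := (f v - f u) / (v - u).
have sE : (v - u) * s = f v - f u by rewrite /s mulrC divfK ?subr_eq0 ?gt_eqF.
set g := fun t => f t - (f u - s * u + s * t + 0 * t ^+ 2).
have gu : g u = 0 by rewrite /g; ring.
have gv : g v = 0.
  by rewrite /g; have -> : f v = f u + (v - u) * s by [lra|]; ring.
have -> : (v - u) * f x - (v - x) * f u - (x - u) * f v = (v - u) * g x.
  have -> : f v = f u + (v - u) * s by lra.
  by rewrite /g; ring.
rewrite ler_pM2l ?subr_gt0 //.
have gC C : K < C -> g x <= K + C / (2 * h ^+ 2) * ((x - u) * (v - x)).
  move=> KC; apply: (@le_parabola_of_second_difference _ g u v h K C) => //.
  - exact: ltW.
  - exact: within_continuous_sub_quadratic.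
  - by move=> y d dh udy ydv; have := fK y d dh udy ydv; rewrite /g; lra.
  - by rewrite in_itv /= !ltW.
(* C = K + e / P is the choice that exceeds the target by exactly e. *)
set P := (x - u) * (v - x) / (2 * h ^+ 2).
have P0 : 0 < P.
  by rewrite divr_gt0 ?mulr_gt0 ?subr_gt0 ?exprn_gt0.
have CP C : C / (2 * h ^+ 2) * ((x - u) * (v - x)) = C * P.
  by rewrite /P; ring.
rewrite CP; apply/ler_addgt0Pr => e e0.
have := gC (K + e / P); rewrite CP ltrDl divr_gt0 // => /(_ isT).
by rewrite mulrDl divfK ?gt_eqF // addrA.
Qed.

(** * From two atoms to finitely many *)

(** Separation argument.  The pairwise hypothesis says that every left slope
G i / (t i - x) is at least every right slope G j / (t j - x); the smallest left
slope - m is therefore the slope of a line through (x, 0) lying above G at all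
atoms, and a line through (x, 0) has average 0. *)
Lemma centered_sum_le0 (R : realFieldType) (I : finType) (p t G : I -> R)
    (x : R) :
  (forall i, 0 <= p i) -> \sum_i p i * (t i - x) = 0 ->
  (forall i, t i = x -> G i <= 0) ->
  (forall i j, t i < x < t j ->
     (t j - x) * G i + (x - t i) * G j <= 0) ->
  \sum_i p i * G i <= 0.
Proof.
move=> p0 px Gx Gij.
have [i0 i0x|noleft] := pickP (fun i => t i < x).
  have [i ix imax] := @arg_maxP _ _ _ _ (fun i => t i < x) (fun i => G i / (x - t i)) i0x.
  set m := G i / (x - t i) in imax.
  have mE : m * (x - t i) = G i by rewrite divfK // subr_eq0 gt_eqF.
  have Gm j : G j <= - m * (t j - x).
    have [jx|xj|tx] := ltgtP (t j) x.
    - have := imax j jx.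
      rewrite /= ler_pdivrMr ?subr_gt0 //; lra.
    - have := Gij i j; rewrite ix xj => /(_ isT).
      rewrite -mE => le0.
      have : (x - t i) * (m * (t j - x) + G j) <= 0 by lra.
      by rewrite pmulr_rle0 ?subr_gt0 //; lra.
    - by have := Gx j tx; rewrite tx subrr mulr0.
  apply: (@le_trans _ _ (- m * \sum_j p j * (t j - x))); last by rewrite px mulr0.
  rewrite mulr_sumr; apply: ler_sum => j _.
  by rewrite mulrCA ler_wpM2l.
(* Without atoms on the left of x, the mean being x leaves no mass on the
   right either. *)
have tx i : 0 <= t i - x by rewrite subr_ge0 leNgt noleft.
have px0 := psumr_eq0P (fun i _ => mulr_ge0 (p0 i) (tx i)) px.
apply: sumr_le0 => i _; have /eqP := px0 i isT.
rewrite mulf_eq0 subr_eq0 => /orP[/eqP ->|/eqP /Gx Gi0]; first by rewrite mul0r.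
by rewrite mulr_ge0_le0.
Qed.

(** The two-atom estimate integrated: D is the variance bound measured in units of
h ^ 2.  A lower bound on second differences controls the deviation from one side;
the other side is the same statement for - f. *)
Lemma centered_average_le (R : realType) (I : finType) (p t : I -> R)
    (f : R -> R) (h K D x : R) :
  0 < h -> {within `[0, 1], continuous f} ->
  (forall y d, 0 <= d <= h -> 0 <= y - d -> y + d <= 1 ->
     - K <= f (y + d) - 2 * f y + f (y - d)) ->
  0 <= x <= 1 -> (forall i, 0 <= t i <= 1) -> (forall i, 0 <= p i) ->
  \sum_i p i = 1 -> \sum_i p i * t i = x ->
  \sum_i p i * (t i - x) ^+ 2 <= h ^+ 2 * D ->
  f x - \sum_i p i * f (t i) <= (1 + 2^-1 * D) * K.
Proof.
move=> h0 fc fK /andP[x0 x1] t01 p0 p1 px pvar.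
have K0 : 0 <= K.
  have := fK x 0; rewrite addr0 subr0 lexx (ltW h0) => /(_ isT x0 x1); lra.
set B := K / (2 * h ^+ 2).
have B0 : 0 <= B by rewrite divr_ge0 // mulr_ge0 // sqr_ge0.
have Bh : B * h ^+ 2 = 2^-1 * K by rewrite /B; field; lra.
pose G i := f x - f (t i) - B * (t i - x) ^+ 2 - K.
suff : \sum_i p i * G i <= 0.
  have -> : \sum_i p i * G i =
      (f x - K) * (\sum_i p i) - \sum_i p i * f (t i)
      - B * \sum_i p i * (t i - x) ^+ 2.
    by rewrite !mulr_sumr -!sumrB; apply: eq_bigr => i _; rewrite /G; ring.
  have := ler_wpM2l B0 pvar; rewrite mulrA Bh p1; lra.
apply: (@centered_sum_le0 _ _ _ t _ x) => //.
- transitivity (\sum_i p i * t i - x * \sum_i p i); last first.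
    by rewrite px p1 mulr1 subrr.
  by rewrite mulr_sumr -sumrB; apply: eq_bigr => i _; ring.
- by move=> i tx; rewrite /G tx; lra.
move=> i j /andP[ix xj].
have [/andP[i0 i1] /andP[j0 j1]] := (t01 i, t01 j).
have fcij : {within `[t i, t j], continuous f}.
  by apply: continuous_subspaceW fc; apply: subset_itv; rewrite bnd_simp.
have := @chord_deviation_le _ f _ _ h K x h0 fcij.
rewrite ix xj -/B => /(_ _ isT) chord.
have : forall y d, 0 <= d <= h -> t i <= y - d -> y + d <= t j ->
     - K <= f (y + d) - 2 * f y + f (y - d).
  by move=> y d dh iyd ydj; apply: fK => //; [exact: le_trans iyd|exact: le_trans j1].
by move=> /chord; rewrite /G; lra.
Qed.

(** * The coefficients and the nodes *)

Local Arguments gamma : simpl never.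

Definition node_coef {R : realType} (n : nat) (w : nat -> R) (k : nat) : R :=
  gamma n w k%:Z + gamma n w (k%:Z - 1).

Lemma gamma_predS (R : realType) (n : nat) (w : nat -> R) (k : nat) :
  gamma n w (k.+1%:Z - 1) = gamma n w k%:Z.
Proof. by rewrite -addn1 PoszD addrK. Qed.

Lemma gamma_pred0 (R : realType) (n : nat) (w : nat -> R) :
  gamma n w (0%:Z - 1) = 0.
Proof. by []. Qed.

Lemma gamma_self (R : realType) (n : nat) (w : nat -> R) : gamma n w n%:Z = 0.
Proof. by rewrite /gamma ltnn. Qed.

Lemma gamma_gt0 (R : realType) (n : nat) (w : nat -> R) (k : nat) :
  (forall k : nat, (k < n)%N -> 0 < w k) -> (k < n)%N -> 0 < gamma n w k%:Z.
Proof.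
move=> w0 kn; rewrite /gamma kn mulr_gt0 ?w0 // ltr0n bin_gt0.
by case: n kn {w0}.
Qed.

Lemma gamma_ge0 (R : realType) (n : nat) (w : nat -> R) (k : int) :
  (forall k : nat, (k < n)%N -> 0 < w k) -> 0 <= gamma n w k.
Proof.
move=> w0; case: k => [k|k] //; have [kn|nk] := ltnP k n.
  exact/ltW/gamma_gt0.
by rewrite /gamma ltnNge nk.
Qed.

Lemma node_coef_gt0 (R : realType) (n : nat) (w : nat -> R) (k : nat) :
  (0 < n)%N -> (forall k : nat, (k < n)%N -> 0 < w k) -> (k <= n)%N ->
  0 < node_coef n w k.
Proof.
move=> n0 w0; rewrite /node_coef leq_eqVlt => /orP[/eqP ->|kn].
  case: n n0 w0 => // n _ w0; rewrite gamma_predS gamma_self add0r.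
  exact: gamma_gt0.
by rewrite ltr_pwDl ?gamma_gt0 ?gamma_ge0.
Qed.

Lemma node_mul_coef (R : realType) (n : nat) (w : nat -> R) (k : nat) :
  (0 < n)%N -> (forall k : nat, (k < n)%N -> 0 < w k) -> (k <= n)%N ->
  node n w k * node_coef n w k = gamma n w (k%:Z - 1).
Proof.
by move=> n0 w0 kn; rewrite /node divfK // gt_eqF // node_coef_gt0.
Qed.

Lemma node0 (R : realType) (n : nat) (w : nat -> R) : node n w 0 = 0.
Proof. by rewrite /node gamma_pred0 mul0r. Qed.

Lemma node_last (R : realType) (n : nat) (w : nat -> R) :
  (0 < n)%N -> (forall k : nat, (k < n)%N -> 0 < w k) -> node n w n = 1.
Proof.
case: n => // n _ w0; rewrite /node gamma_predS gamma_self add0r divff //.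
by rewrite gt_eqF // gamma_gt0.
Qed.

Lemma node_itv (R : realType) (n : nat) (w : nat -> R) (k : nat) :
  (0 < n)%N -> (forall k : nat, (k < n)%N -> 0 < w k) -> (k <= n)%N ->
  0 <= node n w k <= 1.
Proof.
move=> n0 w0 kn; have wk := node_coef_gt0 _ _ _ _ n0 w0 kn.
rewrite /node divr_ge0 ?gamma_ge0 ?(ltW wk) //= ler_pdivrMr // mul1r.
by rewrite lerDr gamma_ge0.
Qed.

(** The nodes lie in the unit interval, hence the supremum in [mesh] is finite. *)
Lemma node_step_le_mesh (R : realType) (n : nat) (w : nat -> R) (k : nat) :
  (0 < n)%N -> (forall k : nat, (k < n)%N -> 0 < w k) -> (k < n)%N ->
  node n w k.+1 - node n w k <= mesh n w.
Proof.
move=> n0 w0 kn; apply: le_trans (ler_norm _) _; apply: ub_le_sup; last by exists k.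
exists 1 => _ [j jn <-].
have := node_itv _ _ w j n0 w0 (ltnW jn).
have := node_itv _ _ w j.+1 n0 w0 jn.
by move=> /andP[? ?] /andP[? ?]; rewrite ler_norml; lra.
Qed.

(** The steps add up to node n - node 0 = 1, so they cannot all be at most 0. *)
Lemma mesh_gt0 (R : realType) (n : nat) (w : nat -> R) :
  (0 < n)%N -> (forall k : nat, (k < n)%N -> 0 < w k) -> 0 < mesh n w.
Proof.
move=> n0 w0; rewrite ltNge; apply/negP => mesh0.
have : \sum_(0 <= k < n) (node n w k.+1 - node n w k) <= 0.
  rewrite big_mkord; apply: sumr_le0 => k _.
  exact: le_trans (node_step_le_mesh _ _ _ _ n0 w0 (ltn_ord k)) mesh0.
by rewrite telescope_sumr // node0 node_last // subr0 ler10.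
Qed.

(** * Moments of the masses *)

(** Here q stands for the value of Q at x; only [gap_mass_sum1] relates the two. *)
Definition node_mass {R : realType} (n : nat) (w : nat -> R) (q x : R) (k : nat) : R :=
  node_coef n w k * (x ^+ k * (1 - x) ^+ (n - k) / q).

(** The normalized Bernstein terms of Q itself.  They are attached to the gaps
between consecutive nodes because the mass of the gap j is shared between
[node n w j] and [node n w j.+1] in proportion 1 - x to x. *)
Definition gap_mass {R : realType} (n : nat) (w : nat -> R) (q x : R)
    (j : nat) : R :=
  gamma n w j%:Z * (x ^+ j * (1 - x) ^+ (n.-1 - j)) / q.

(** Shifting the index turns the gamma_(k-1) half of the node masses into gap
masses of the right ends; the missing term is gamma_(-1) = 0. *)
Lemma sum_gamma_pred (R : realType) (n : nat) (w : nat -> R) (q x : R)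
    (F : nat -> R) :
  (0 < n)%N ->
  \sum_(k < n.+1) F k * (gamma n w (k%:Z - 1) * (x ^+ k * (1 - x) ^+ (n - k) / q))
    = x * \sum_(j < n) gap_mass n w q x j * F j.+1.
Proof.
move=> n0; rewrite big_ord_recl gamma_pred0 mul0r mulr0 add0r mulr_sumr.
apply: eq_bigr => j _; rewrite /gap_mass lift0 gamma_predS exprS.
have -> : (n - j.+1 = n.-1 - j)%N by lia.
by ring.
Qed.

(** Each node mass is a sum of a gamma_k part, where n - k contributes one more
factor 1 - x than n - 1 - k, and a gamma_(k-1) part, where x ^ k contributes one
more factor x. *)
Lemma sum_node_mass (R : realType) (n : nat) (w : nat -> R) (q x : R)
    (F : nat -> R) :
  (0 < n)%N ->
  \sum_(k < n.+1) node_mass n w q x k * F k =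
    \sum_(j < n) gap_mass n w q x j * ((1 - x) * F j + x * F j.+1).
Proof.
move=> n0.
transitivity ((1 - x) * \sum_(j < n) gap_mass n w q x j * F j
    + x * \sum_(j < n) gap_mass n w q x j * F j.+1); last first.
  by rewrite !mulr_sumr -big_split; apply: eq_bigr => j _ /=; ring.
rewrite -sum_gamma_pred // mulr_sumr.
transitivity (\sum_(k < n.+1)
    F k * (gamma n w k%:Z * (x ^+ k * (1 - x) ^+ (n - k) / q)) +
  \sum_(k < n.+1)
    F k * (gamma n w (k%:Z - 1) * (x ^+ k * (1 - x) ^+ (n - k) / q))).
  by rewrite -big_split; apply: eq_bigr => k _ /=; rewrite -mulrDr -mulrDl mulrC.
congr (_ + _); rewrite big_ord_recr /= gamma_self mul0r mulr0 addr0.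
apply: eq_bigr => j _; rewrite /gap_mass.
have -> : (n - j = (n.-1 - j).+1)%N by have := ltn_ord j; lia.
by rewrite exprS; ring.
Qed.

Lemma gap_mass_sum1 (R : realType) (n : nat) (w : nat -> R) (Q : {poly R})
    (x : R) :
  bernstein_expansion n w Q -> Q.[x] != 0 ->
  \sum_(j < n) gap_mass n w Q.[x] x j = 1.
Proof.
move=> Qw Q0; rewrite -mulr_suml [X in X / _](_ : _ = Q.[x]) ?divff //.
rewrite [in RHS]Qw horner_sum; apply: eq_bigr => j _.
by rewrite !hornerE.
Qed.

(** By the choice of the nodes, multiplying by the node position keeps only the
gamma_(k-1) part of its mass.  With F = 1 this is the reproduction of the
identity function, with F the node position it is the second moment. *)
Lemma node_mass_mean_mul (R : realType) (n : nat) (w : nat -> R) (q x : R)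
    (F : nat -> R) :
  (0 < n)%N -> (forall k : nat, (k < n)%N -> 0 < w k) ->
  \sum_(k < n.+1) node_mass n w q x k * (node n w k * F k) =
    x * \sum_(j < n) gap_mass n w q x j * F j.+1.
Proof.
move=> n0 w0; rewrite -sum_gamma_pred //; apply: eq_bigr => k _.
by rewrite -(node_mul_coef _ _ w k n0 w0) -1?ltnS // /node_mass; ring.
Qed.

Lemma node_mass_sum1 (R : realType) (n : nat) (w : nat -> R) (q x : R) :
  (0 < n)%N -> \sum_(j < n) gap_mass n w q x j = 1 ->
  \sum_(k < n.+1) node_mass n w q x k = 1.
Proof.
move=> n0 q1; transitivity (\sum_(k < n.+1) node_mass n w q x k * 1).
  by apply: eq_bigr => k _; rewrite mulr1.
rewrite (sum_node_mass _ _ w q x (fun=> 1)) // -[RHS]q1.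
by apply: eq_bigr => j _; ring.
Qed.

Lemma node_mass_mean (R : realType) (n : nat) (w : nat -> R) (q x : R) :
  (0 < n)%N -> (forall k : nat, (k < n)%N -> 0 < w k) ->
  \sum_(j < n) gap_mass n w q x j = 1 ->
  \sum_(k < n.+1) node_mass n w q x k * node n w k = x.
Proof.
move=> n0 w0 q1.
transitivity (\sum_(k < n.+1) node_mass n w q x k * (node n w k * 1)).
  by apply: eq_bigr => k _; rewrite mulr1.
by rewrite (node_mass_mean_mul _ _ w q x (fun=> 1)) // -mulr_suml q1 !mulr1.
Qed.

(** The second moment is x * U, where U is the average of the right ends of the
gaps; writing the mean as x = (1 - x) * V + x * U, with V the average of the
left ends, gives U - x = (1 - x) * (U - V). *)
Lemma node_mass_variance (R : realType) (n : nat) (w : nat -> R) (q x : R) :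
  (0 < n)%N -> (forall k : nat, (k < n)%N -> 0 < w k) ->
  \sum_(j < n) gap_mass n w q x j = 1 ->
  \sum_(k < n.+1) node_mass n w q x k * (node n w k - x) ^+ 2
    = x * (1 - x)
      * \sum_(j < n) gap_mass n w q x j * (node n w j.+1 - node n w j).
Proof.
move=> n0 w0 q1.
have m0 := node_mass_sum1 _ _ w q x n0 q1.
have m1 := node_mass_mean _ _ w q x n0 w0 q1.
set V := \sum_(j < n) gap_mass n w q x j * node n w j.
set U := \sum_(j < n) gap_mass n w q x j * node n w j.+1.
have -> : \sum_(j < n) gap_mass n w q x j * (node n w j.+1 - node n w j) = U - V.
  by rewrite -sumrB; apply: eq_bigr => j _; rewrite mulrBr.
have xE : x = (1 - x) * V + x * U.
  rewrite -[LHS]m1 (sum_node_mass _ _ w) // /V /U !mulr_sumr -big_split.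
  by apply: eq_bigr => j _ /=; ring.
have UE : U - x = (1 - x) * (U - V) by lra.
transitivity (
    \sum_(k < n.+1) node_mass n w q x k * (node n w k * node n w k)
    - 2 * x * (\sum_(k < n.+1) node_mass n w q x k * node n w k)
    + x ^+ 2 * \sum_(k < n.+1) node_mass n w q x k).
  by rewrite !mulr_sumr -sumrB -big_split; apply: eq_bigr => k _ /=; ring.
by rewrite node_mass_mean_mul // m0 m1 -(mulrA x) -UE -/U; ring.
Qed.

Lemma node_mass_variance_le (R : realType) (n : nat) (w : nat -> R) (q x : R) :
  (0 < n)%N -> (forall k : nat, (k < n)%N -> 0 < w k) ->
  0 < q -> 0 <= x <= 1 -> \sum_(j < n) gap_mass n w q x j = 1 ->
  \sum_(k < n.+1) node_mass n w q x k * (node n w k - x) ^+ 2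
    <= mesh n w * (x * (1 - x)).
Proof.
move=> n0 w0 q0 /andP[x0 x1] q1; rewrite node_mass_variance //.
rewrite [leRHS]mulrC ler_wpM2l ?mulr_ge0 ?subr_ge0 //.
rewrite -[leRHS]mulr1 -q1 mulr_sumr; apply: ler_sum => j _.
rewrite mulrC ler_wpM2r ?node_step_le_mesh //.
by rewrite divr_ge0 ?(ltW q0) // !mulr_ge0 ?gamma_ge0 ?exprn_ge0 ?subr_ge0.
Qed.

(** * The estimate *)

Theorem theorem10 (R : realType) (n : nat) (Q : {poly R}) (w : nat -> R)
  (n_ge1 : (1 <= n)%N)
  (degQ : (size Q <= n)%N)
  (Q_gt0 : forall x : R, x \in `[0, 1] -> 0 < Q.[x])
  (Qw : bernstein_expansion n w Q)
  (w_gt0 : forall k : nat, (k < n)%N -> 0 < w k)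
  (wW : propertyW n w)
  (f : R -> R) (f_cont : {within `[0, 1], continuous f})
  (x : R) (x01 : x \in `[0, 1]) :
  `|rational_bernstein n w Q f x - f x|
    <= (1 + 2^-1 * (x * (1 - x))) * omega2 f (Num.sqrt (mesh n w)).
Proof.
set D := mesh n w; set h := Num.sqrt D; set K := omega2 f h.
have Q0 := Q_gt0 x x01.
move: (x01); rewrite in_itv /= => x01'; have /andP[x0 x1] := x01'.
have D0 : 0 < D by exact: mesh_gt0.
have h0 : 0 < h by rewrite sqrtr_gt0.
have hh : h ^+ 2 = D by rewrite sqr_sqrtr // ltW.
have q1 := gap_mass_sum1 _ _ _ _ x Qw (lt0r_neq0 Q0).
have t01 (k : 'I_n.+1) : 0 <= node n w k <= 1.
  by apply: node_itv; rewrite // -ltnS.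
have p0 (k : 'I_n.+1) : 0 <= node_mass n w Q.[x] x k.
  rewrite mulr_ge0 //; first by rewrite ltW // node_coef_gt0 // -ltnS.
  by rewrite divr_ge0 ?(ltW Q0) // mulr_ge0 ?exprn_ge0 ?subr_ge0.
have p1 := node_mass_sum1 _ _ _ _ _ n_ge1 q1.
have px := node_mass_mean _ _ _ _ _ n_ge1 w_gt0 q1.
have pvar := node_mass_variance_le _ _ _ _ _ n_ge1 w_gt0 Q0 x01' q1.
rewrite -/D -hh in pvar.
have fK y d : 0 <= d <= h -> 0 <= y - d -> y + d <= 1 ->
    - K <= f (y + d) - 2 * f y + f (y - d) <= K.
  move=> /andP[d0 dh] y0 y1; rewrite -ler_norml.
  by apply: second_difference_le_omega2 => //;
    rewrite ?in_itv /= ?ger0_norm //; lra.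
have RE : rational_bernstein n w Q f x =
    \sum_(k < n.+1) node_mass n w Q.[x] x k * f (node n w k).
  by apply: eq_bigr => k _; rewrite -mulrA mulrC.
have up : f x - rational_bernstein n w Q f x <= (1 + 2^-1 * (x * (1 - x))) * K.
  rewrite RE; apply: (@centered_average_le _ _ _ _ f h) => //.
  by move=> y d dh y0 y1; have /andP[] := fK y d dh y0 y1.
have lo : - f x - - rational_bernstein n w Q f x
    <= (1 + 2^-1 * (x * (1 - x))) * K.
  rewrite RE -sumrN -[X in - _ - X](eq_bigr _ (fun k _ => mulrN _ _)).
  apply: (@centered_average_le _ _ _ _ (fun y => - f y) h) => //.
    by move=> y; apply: continuousN; exact: f_cont.
  by move=> y d dh y0 y1; have /andP[] := fK y d dh y0 y1; lra.
by rewrite ler_norml; lra.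
Qed.
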